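(* Let $u_n:=|\mathfrak{A}_{2n+1}(1342,2431)|$ for $n\ge0$ and $U(x):=\sum_{n\ge0}u_nx^n$. Then $$U(x)=\frac{\sqrt{1-4x}}{\sqrt{1-4x}-2x}=\cfrac{1}{1-\cfrac{2x}{1-\cfrac{2x}{1-\cfrac{x}{1-\cfrac{x}{\ddots}}}}},$$ where in the continued fraction all partial numerators after the first two equal $x$.
   Context: $\mathfrak{A}_m(1342,2431)$ is the set of permutations $\pi$ of $[m]$ that are alternating (up-down), i.e. $\pi(1)<\pi(2)>\pi(3)<\pi(4)>\cdots$, and avoid both classical patterns $1342$ and $2431$. *)

(* Defs.v *)
From HB Require Import structures.
From mathcomp Require Import all_boot all_order all_algebra all_fingroup.
Set Implicit Arguments. Unset Strict Implicit. Unset Printing Implicit Defensive.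
Import Order.TTheory GRing.Theory Num.Theory.

(* pi(1) < pi(2) > pi(3) < ... ; positions here are 0-based, so the
   step from position i to i+1 is an ascent iff i is even. *)
Definition alternating (m : nat) (pi : 'S_m) : bool :=
  [forall i : 'I_m, forall j : 'I_m,
     (nat_of_ord j == (nat_of_ord i).+1) ==>
       (if odd i then pi j < pi i else pi i < pi j)]%N.

(* pi contains the classical pattern p (given in one-line notation as a
   sequence of distinct naturals, e.g. [:: 1; 3; 4; 2]) iff there are
   positions f 0 < f 1 < ... whose values are order-isomorphic to p. *)
Definition contains (p : seq nat) (m : nat) (pi : 'S_m) : bool :=
  [exists f : {ffun 'I_(size p) -> 'I_m},
     [forall a : 'I_(size p), forall b : 'I_(size p),
        ((a < b) ==> (f a < f b)) &&
        ((pi (f a) < pi (f b)) == (nth 0 p a < nth 0 p b))]]%N.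

Definition avoids (p : seq nat) (m : nat) (pi : 'S_m) : bool :=
  ~~ contains p pi.

Definition alt_avoid_count (m : nat) : nat :=
  #|[set pi : 'S_m | [&& alternating pi, avoids [:: 1; 3; 4; 2] pi
                        & avoids [:: 2; 4; 3; 1] pi]]|.

Definition u (n : nat) : nat := alt_avoid_count (2 * n + 1).

Local Open Scope ring_scope.

Definition series := nat -> rat.

Definition sconst (c : rat) : series := fun n => if n == 0%N then c else 0.
Definition sone : series := sconst 1.
Definition sX : series := fun n => if n == 1%N then 1 else 0.
Definition sadd (a b : series) : series := fun n => a n + b n.
Definition sopp (a : series) : series := fun n => - a n.
Definition ssub (a b : series) : series := fun n => a n - b n.
Definition sscale (c : rat) (a : series) : series := fun n => c * a n.
Definition smul (a b : series) : series :=
  fun n => \sum_(i < n.+1) a i * b (n - i)%N.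

(* coefficients b_0 .. b_n of the multiplicative inverse of a
   (meaningful when a 0 <> 0):
   b_0 = 1/a_0,  b_{n+1} = -(1/a_0) * sum_{k=1}^{n+1} a_k b_{n+1-k}. *)
Fixpoint inv_upto (a : series) (n : nat) : seq rat :=
  match n with
  | 0%N => [:: (a 0%N)^-1]
  | n'.+1 =>
      let bs := inv_upto a n' in
      rcons bs (- (a 0%N)^-1 *
                \sum_(k < n'.+1) a k.+1 * nth 0 bs (n' - k)%N)
  end.

Definition sinv (a : series) : series := fun n => nth 0 (inv_upto a n) n.

Definition U : series := fun n => (u n)%:R.

Definition cf_num (j : nat) : rat := if (j <= 2)%N then 2 else 1.

(* cf_tail k j = 1/(1 - c_j x/(1 - c_{j+1} x/(... /(1 - c_{j+k-1} x)))),
   i.e. the continued fraction starting at level j, truncated after k levels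
   (the innermost tail replaced by 1). *)
Fixpoint cf_tail (k j : nat) : series :=
  match k with
  | 0%N => sone
  | k'.+1 => sinv (ssub sone (sscale (cf_num j) (smul sX (cf_tail k' j.+1))))
  end.

Definition cf_convergent (m : nat) : series := cf_tail m 1.

(* Main.v *)
Require Import Defs.
From HB Require Import structures.
From Stdlib Require Import FunctionalExtensionality Ring.
From mathcomp Require Import all_boot all_order all_algebra all_fingroup.
From mathcomp Require Import zify.
Import Order.TTheory GRing.Theory Num.Theory.

(** Let [m' < m] be the two largest letters of an up-down word [s] of odd length
    at least 3 avoiding 1342 and 2431.  The class is closed under reversal, so
    suppose that [m'] stands to the left of [m].  Either [s = m' m R] with [R] in
    the class, or [s = P m' Q] where [P] and [Q] are again up-down of odd length.
    In the second case avoidance forces every letter of [P] to exceed every letter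
    of [Q] other than [m], and [P] to avoid 132; conversely every such pair gives
    a word of the class.  Up-down words of odd length avoiding 132 split at their
    maximum in the same way and are counted by the Catalan series
    [C = 1 + x C^2].  Hence [U = 1 + 2 x U + 2 x C (U - 1)].  Since
    [s = 1 - 2 x C] is the square root of [1 - 4 x], this reads
    [U (s - 2 x) = s], and [C = 1 / (1 - x C)], [1 / s = 1 / (1 - 2 x C)],
    [U = 1 / (1 - 2 x / s)] unfold the continued fraction. *)

Local Open Scope nat_scope.

(** * Words and patterns *)

(** Reads a peak and a valley at a time, [x] being the last valley. A single leftover letter is
    rejected, so odd length is built into [zigzag]. *)
Fixpoint zigzag_from (x : nat) (s : seq nat) : bool :=
  match s with
  | [::] => true
  | [:: _] => false
  | y :: z :: s' => [&& x < y, z < y & zigzag_from z s']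
  end.

Definition zigzag (s : seq nat) : bool :=
  if s is x :: s' then zigzag_from x s' else false.

Definition order_iso (p t : seq nat) : bool :=
  (size t == size p) &&
  all (fun a => all (fun b => (nth 0 t a < nth 0 t b) == (nth 0 p a < nth 0 p b))
    (iota 0 (size p))) (iota 0 (size p)).

(** Boolean masks form a finite type and produce all subsequences, which makes containment
    decidable. *)
Definition seq_contains (p s : seq nat) : bool :=
  [exists m : (size s).-tuple bool, order_iso p (mask m s)].

Lemma seq_containsP p s :
  reflect (exists2 t, subseq t s & order_iso p t) (seq_contains p s).
Proof.
apply: (iffP existsP) => [[m mP]|[t /subseqP[m sm ->] tP]].
  by exists (mask m s); rewrite ?mask_subseq.
have ms : size m == size s by rewrite sm.
by exists (Tuple ms).
Qed.

(** Here and in the next two lemmas the letters are named by increasing value, so their order in the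
    list displays the pattern. *)
Lemma avoid132P s :
  reflect (forall a b c, subseq [:: a; c; b] s -> a < b -> b < c -> False)
          (~~ seq_contains [:: 1; 3; 2] s).
Proof.
apply: (iffP idP) => [/seq_containsP H a b c st ab bc|H].
  by apply: H; exists [:: a; c; b] => //; rewrite /order_iso /=; lia.
apply/seq_containsP => -[[|a [|c [|b [|? ?]]]] // st]; rewrite /order_iso /= => i.
by apply: (H a b c st); lia.
Qed.

Lemma avoid1342P s :
  reflect (forall a b c d, subseq [:: a; c; d; b] s ->
             a < b -> b < c -> c < d -> False)
          (~~ seq_contains [:: 1; 3; 4; 2] s).
Proof.
apply: (iffP idP) => [/seq_containsP H a b c d st ab bc cd|H].
  by apply: H; exists [:: a; c; d; b] => //; rewrite /order_iso /=; lia.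
apply/seq_containsP => -[[|a [|c [|d [|b [|? ?]]]]] // st]; rewrite /order_iso /= => i.
by apply: (H a b c d st); lia.
Qed.

Lemma avoid2431P s :
  reflect (forall a b c d, subseq [:: b; d; c; a] s ->
             a < b -> b < c -> c < d -> False)
          (~~ seq_contains [:: 2; 4; 3; 1] s).
Proof.
apply: (iffP idP) => [/seq_containsP H a b c d st ab bc cd|H].
  by apply: H; exists [:: b; d; c; a] => //; rewrite /order_iso /=; lia.
apply/seq_containsP => -[[|b [|d [|c [|a [|? ?]]]]] // st]; rewrite /order_iso /= => i.
by apply: (H a b c d st); lia.
Qed.

Definition avoid_both (s : seq nat) : bool :=
  ~~ seq_contains [:: 1; 3; 4; 2] s && ~~ seq_contains [:: 2; 4; 3; 1] s.

Lemma avoid_both_sub s t : subseq s t -> avoid_both t -> avoid_both s.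
Proof.
move=> st /andP[/avoid1342P H1 /avoid2431P H2]; apply/andP; split.
  by apply/avoid1342P => a b c d sb; apply: H1; apply: subseq_trans st.
by apply/avoid2431P => a b c d sb; apply: H2; apply: subseq_trans st.
Qed.

Lemma avoid132_sub s t : subseq s t ->
  ~~ seq_contains [:: 1; 3; 2] t -> ~~ seq_contains [:: 1; 3; 2] s.
Proof.
move=> st /avoid132P H; apply/avoid132P => a b c sb.
by apply: H; apply: subseq_trans st.
Qed.

(** Reversal exchanges the patterns 1342 and 2431. *)
Lemma avoid_both_rev s : avoid_both s -> avoid_both (rev s).
Proof.
move=> /andP[/avoid1342P H1 /avoid2431P H2]; apply/andP; split.
  apply/avoid1342P => a b c d; rewrite -subseq_rev revK => sb ab bc cd.
  exact: (H2 a b c d).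
apply/avoid2431P => a b c d; rewrite -subseq_rev revK => sb ab bc cd.
exact: (H1 a b c d).
Qed.

Lemma subseq_catP (T : eqType) (t s1 s2 : seq T) : subseq t (s1 ++ s2) ->
  exists t1 t2, [/\ t = t1 ++ t2, subseq t1 s1 & subseq t2 s2].
Proof.
move=> /subseqP[m sm ->]; exists (mask (take (size s1) m) s1), (mask (drop (size s1) m) s2).
rewrite !mask_subseq -mask_cat ?cat_take_drop //.
by rewrite size_takel // sm size_cat leq_addr.
Qed.

Lemma cat_mid_inj (T : eqType) (m : T) (P1 P2 Q1 Q2 : seq T) :
  m \notin P1 -> m \notin P2 -> P1 ++ m :: Q1 = P2 ++ m :: Q2 ->
  P1 = P2 /\ Q1 = Q2.
Proof.
elim: P1 P2 => [|x P1 IH] [|y P2] //=.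
- by move=> _ _ [].
- by rewrite inE negb_or => _ /andP[/eqP ne _] [e]; case: ne.
- by rewrite inE negb_or => /andP[/eqP ne _] _ [e]; case: ne.
rewrite !inE !negb_or => /andP[_ h1] /andP[_ h2] [-> e].
by have [-> ->] := IH _ h1 h2 e.
Qed.

(** Induction in steps of two letters, matching the recursion of [zigzag_from]. *)
Lemma seq_pair_ind (T : Type) (K : seq T -> Prop) :
  K [::] -> (forall x, K [:: x]) -> (forall x y s, K s -> K [:: x, y & s]) ->
  forall s, K s.
Proof.
move=> K0 K1 K2 s; suff [] : K s /\ forall x, K (x :: s) by [].
by elim: s => [|y s [IH1 IH2]]; split=> // x; apply: K2.
Qed.

(** The ascent into [m] makes [m] a peak. If [P] has odd length, [m] falls on a valley position and
    both sides are false. *)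
Lemma zigzag_from_cat x P m Q : last x P < m ->
  zigzag_from x (P ++ m :: Q) = [&& zigzag_from x P, zigzag Q & head m Q < m].
Proof.
elim/seq_pair_ind: P x => [|y|y z P IH] x /=.
- by case: Q => [|z Q] /= h; rewrite ?h ?andbF //= andbC.
- by move=> h; rewrite [m < y]ltnNge (ltnW h) andbF.
by move=> h; rewrite IH //; rewrite -!andbA.
Qed.

Lemma zigzag_cat P m Q : P != [::] -> last 0 P < m ->
  zigzag (P ++ m :: Q) = [&& zigzag P, zigzag Q & head m Q < m].
Proof. by case: P => // x P _ /= h; rewrite zigzag_from_cat. Qed.

Lemma zigzag_odd s : zigzag s -> odd (size s).
Proof.
case: s => //= x s; elim/seq_pair_ind: s x => // y z s IH x /= /and3P[_ _ /IH].
by rewrite negbK.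
Qed.

Lemma zigzag_rev s : zigzag s -> zigzag (rev s).
Proof.
case: s => // x s; elim/seq_pair_ind: s x => // y z s IH x /= /and3P[xy zy h].
have {IH} := IH _ h; rewrite !rev_cons -!cats1 -catA /= => hz.
rewrite zigzag_cat /=; first by rewrite hz.
  by case: (rev s).
by rewrite last_cat.
Qed.
Lemma zigzag_head s : zigzag s -> 1 < size s -> head 0 s < nth 0 s 1.
Proof. by case: s => [|x [|y [|z s]]] //= /and3P[]. Qed.

Lemma subseq_memP (T : eqType) (x : T) (t s : seq T) :
  subseq (x :: t) s -> x \in s /\ subseq t s.
Proof.
move=> h; split; first by apply: (mem_subseq h); rewrite mem_head.
by apply: subseq_trans h; apply: subseq_cons.
Qed.

Lemma subseq_consP (T : eqType) (x y : T) (t s : seq T) :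
  subseq (x :: t) (y :: s) -> (x = y /\ subseq t s) \/ subseq (x :: t) s.
Proof. by move=> /=; case: eqP => [->|_]; [left|right]. Qed.

(** * Pattern avoidance when words are glued or split at a large letter *)

Lemma avoid132_cat P m Q :
  {in P & Q, forall x y, y < x} -> {in P, forall x, x < m} ->
  {in Q, forall x, x < m} ->
  ~~ seq_contains [:: 1; 3; 2] P -> ~~ seq_contains [:: 1; 3; 2] Q ->
  ~~ seq_contains [:: 1; 3; 2] (P ++ m :: Q).
Proof.
move=> PQ Pm Qm /avoid132P hP /avoid132P hQ; apply/avoid132P => a b c.
have mQ x : x \in m :: Q -> x = m \/ x < m /\ x \in Q.
  by rewrite inE => /orP[/eqP|xQ]; [left|right; split => //; apply: Qm].
(* The cases count the letters of the occurrence lying in [P]. If [a] is in [P] and [b] is not, then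
   [b < a] or [b = m], and the latter leaves no room for [c]. *)
move=> /subseq_catP[[|x [|y [|z [|w t1]]]] [t2 [e s1 s2]]] ab bc; rewrite /= in e.
- rewrite -e in s2; case/subseq_consP: s2 => [[am]|]; last by move/hQ; lia.
  by move=> /subseq_memP[/Qm ? _]; lia.
- case: e => ax e; subst x; move: s1; rewrite sub1seq => aP; rewrite -e in s2.
  case/subseq_memP: s2 => /mQ hc; rewrite sub1seq => /mQ.
  case: hc => [?|[? _]] [?|[? /(PQ a b aP) ?]]; lia.
- case: e => ax cy e; subst x y; rewrite -e in s2.
  case/subseq_memP: s1 => aP; rewrite sub1seq => /Pm ?.
  move: s2; rewrite sub1seq => /mQ[?|[? /(PQ a b aP) ?]]; lia.
- case: e => ax cy bz e; subst x y z; exact: (hP a b c).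
by [].
Qed.

(** Letters [x < y] on the left and right of [m] would form the occurrence [x m y] of 132. *)
Lemma avoid132_gt P m Q : uniq (P ++ m :: Q) -> {in Q, forall x, x < m} ->
  ~~ seq_contains [:: 1; 3; 2] (P ++ m :: Q) ->
  {in P & Q, forall x y, y < x}.
Proof.
move=> U Qm /avoid132P h x y xP yQ; rewrite ltnNge; apply/negP => xy.
apply: (h x y m) => //; last exact: Qm.
  by rewrite -cat1s; apply: cat_subseq; rewrite /= ?eqxx sub1seq.
rewrite ltn_neqAle xy andbT; apply/eqP => e; subst y.
move: U; rewrite cat_uniq => /and3P[_ /hasPn H _].
by have := H x; rewrite inE yQ orbT xP => /(_ isT).
Qed.

(** Both patterns begin with a letter that at least two later letters exceed. Neither [m'] nor [m]
    can play that role, so an occurrence would lie in [R]. *)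
Lemma avoid_both_cons2 m' m R : m' < m -> {in R, forall x, x < m'} ->
  avoid_both R -> avoid_both (m' :: m :: R).
Proof.
move=> mm Rm /andP[/avoid1342P h1 /avoid2431P h2].
have lem x : x \in [:: m', m & R] -> x <= m.
  by rewrite !inE => /or3P[/eqP ->|/eqP ->|/Rm]; lia.
have lem2 x : x \in m :: R -> x <= m' \/ x = m.
  by rewrite !inE => /orP[/eqP ->|/Rm]; lia.
apply/andP; split; [apply/avoid1342P|apply/avoid2431P] => a b c d s ab bc cd.
- case/subseq_memP: (s) => _ /subseq_memP[/lem ? /subseq_memP[/lem ? /subseq_memP[/lem ? _]]].
  case/subseq_consP: s => [[am]|].
    by move=> /subseq_memP[/lem2 ? /subseq_memP[/lem2 ? _]]; lia.
  by move=> /subseq_consP[[]|/h1]; lia.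
case/subseq_memP: (s) => _ /subseq_memP[/lem ? /subseq_memP[/lem ? _]].
case/subseq_consP: s => [[am]|].
  by move=> /subseq_memP[/lem2 ? /subseq_memP[/lem2 ? _]]; lia.
by move=> /subseq_consP[[]|/h2]; lia.
Qed.

(** An occurrence starting in [P] must keep its letter of value 2 (for 1342) or 3 (for 2431) in [P],
    because the letters to the right of [P] are too small or too large for it; this leaves a 132
    inside [P]. An occurrence starting later lies in [Q], as only [m] exceeds [m']. *)
Lemma avoid_both_cat P m' m Q : uniq (P ++ m' :: Q) -> m' < m ->
  {in P, forall x, x < m'} -> {in Q, forall y, y < m' \/ y = m} ->
  {in P & Q, forall x y, y < x \/ y = m} ->
  ~~ seq_contains [:: 1; 3; 2] P -> avoid_both Q ->
  avoid_both (P ++ m' :: Q).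
Proof.
move=> U mm Pm Qm PQ /avoid132P hP /andP[/avoid1342P h1 /avoid2431P h2].
have m'Q : m' \notin Q.
  by move: U; rewrite cat_uniq /= => /and3P[_ _ /andP[]].
have memQ x : x \in m' :: Q -> x <= m' \/ x = m.
  by rewrite inE => /orP[/eqP ->|/Qm]; lia.
apply/andP; split.
  apply/avoid1342P => a b c d s ab bc cd.
  have bnd x : x \in P ++ m' :: Q -> x <= m' \/ x = m.
    by rewrite mem_cat => /orP[/Pm|/memQ]; lia.
  case/subseq_memP: (s) => /bnd ? /subseq_memP[/bnd ? /subseq_memP[/bnd ? _]].
  have bP : a \in P -> b \in m' :: Q -> False.
    by move=> aP; rewrite inE => /orP[/eqP ?|/(PQ a b aP)]; lia.
  case/subseq_catP: s => [[|x [|y [|z [|w [|? ?]]]]] [t2 [e s1 s2]]]; rewrite /= in e => //.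
  - rewrite -e in s2; case/subseq_consP: s2 => [[am _]|/h1]; lia.
  - case: e => ax e; subst x; rewrite -e in s2; apply: bP; first by rewrite -sub1seq.
    by apply: (mem_subseq s2); rewrite !inE eqxx ?orbT.
  - case: e => ax cy e; subst x y; rewrite -e in s2; apply: bP.
      by case/subseq_memP: s1.
    by apply: (mem_subseq s2); rewrite !inE eqxx ?orbT.
  - case: e => ax cy cz e; subst x y z; rewrite -e in s2; apply: bP.
      by case/subseq_memP: s1.
    by apply: (mem_subseq s2); rewrite !inE eqxx ?orbT.
  case: e => ax cy cz dw e; subst x y z w.
  apply: (hP a b d) => //; last by lia.
  (* Dropping [c] leaves [a d b], a 132 inside [P]. *)
  by apply: subseq_trans s1; apply/subseqP; exists [:: true; false; true; true].
(* The occurrence of 2431 reads [t q r p], with [p < t < r < q]. *)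
apply/avoid2431P => p t r q s pt tr rq.
have bnd x : x \in P ++ m' :: Q -> x <= m' \/ x = m.
  by rewrite mem_cat => /orP[/Pm|/memQ]; lia.
case/subseq_memP: (s) => /bnd ? /subseq_memP[/bnd ? /subseq_memP[/bnd ? _]].
have rP : t \in P -> r \in Q -> False.
  by move=> tP /(PQ t r tP); lia.
case/subseq_catP: s => [[|x [|y [|z t1]]] [t2 [e s1 s2]]]; rewrite /= in e.
- rewrite -e in s2; case/subseq_consP: s2 => [[am _]|/h2]; lia.
- case: e => ax e; subst x; rewrite -e in s2; move: s1; rewrite sub1seq => tP.
  apply: rP => //; case/subseq_consP: s2 => [[_ /subseq_memP[]]|] //.
  by case/subseq_memP => _ /subseq_memP[].
- case: e => ax cy e; subst x y; rewrite -e in s2.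
  case/subseq_memP: s1 => tP; rewrite sub1seq => /Pm ?.
  case/subseq_memP: s2 => + _; rewrite inE => /orP[/eqP ?|/(rP tP) //]; lia.
case: e => ax cy cz e; subst x y z.
apply: (hP t r q) => //.
exact: subseq_trans (prefix_subseq [:: t; q; r] t1) s1.
Qed.

(** For [x] in [P], a larger [y] in [R] would give the 1342 [x m' m y]. Hence any [r] in [R] is
    below all of [P]. Then a larger [y] in [Q'] would give the 2431 [x m' y r], and a 132 [a c b] in
    [P] would give the 2431 [a c b r]. *)
Lemma avoid_both_split P m' Q' m R : uniq (P ++ m' :: Q' ++ m :: R) ->
  R != [::] -> m' < m ->
  {in P, forall x, x < m'} -> {in Q', forall x, x < m'} ->
  {in R, forall x, x < m'} ->
  avoid_both (P ++ m' :: Q' ++ m :: R) ->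
  {in P & Q' ++ m :: R, forall x y, y < x \/ y = m} /\
  ~~ seq_contains [:: 1; 3; 2] P.
Proof.
case: R => // r R U _ mm Pm Qm Rm /andP[/avoid1342P h1 /avoid2431P h2].
have R1 x y : x \in P -> y \in r :: R -> y < x.
  move=> xP yR; have := Pm _ xP; have := Rm _ yR => ? ?.
  case: (ltngtP y x) => // [xy|e].
    exfalso; apply: (h1 x y m' m) => //.
    apply: (@cat_subseq _ [:: x] [:: m'; m; y]); first by rewrite sub1seq.
    apply: (@cat_subseq _ [:: m'] [:: m; y] [:: m']) => //.
    apply: (@cat_subseq _ [::] [:: m; y] Q'); first exact: sub0seq.
    by apply: (@cat_subseq _ [:: m] [:: y] [:: m]) => //; rewrite sub1seq.
  subst y; move: U; rewrite cat_uniq => /and3P[_ /hasPn H _].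
  by have := H x; rewrite inE mem_cat inE yR !orbT xP => /(_ isT).
have rR : r \in r :: R by rewrite mem_head.
split.
  move=> x y xP; rewrite mem_cat inE => /or3P[yQ|/eqP ->|/(R1 _ _ xP)]; [|by right|by left].
  left; have := Pm _ xP; have := Qm _ yQ => ? ?; have rx := R1 _ _ xP rR.
  case: (ltngtP y x) => // [xy|e].
    exfalso; apply: (h2 r x y m') => //.
    apply: (@cat_subseq _ [:: x] [:: m'; y; r]); first by rewrite sub1seq.
    apply: (@cat_subseq _ [:: m'] [:: y; r] [:: m']) => //.
    apply: (@cat_subseq _ [:: y] [:: r] Q'); first by rewrite sub1seq.
    by rewrite sub1seq !inE eqxx orbT.
  subst y; move: U; rewrite cat_uniq => /and3P[_ /hasPn H _].
  by have := H x; rewrite inE mem_cat yQ !orbT xP => /(_ isT).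
apply/avoid132P => a b c s ab bc.
have aP : a \in P by case/subseq_memP: s.
apply: (h2 r a b c) => //; last exact: R1.
rewrite -[[:: a; c; b; r]]/([:: a; c; b] ++ [:: r]); apply: cat_subseq => //.
by rewrite sub1seq inE mem_cat !inE eqxx !orbT.
Qed.

(** * Counting words over a sorted alphabet *)

(** The alphabet is arbitrary because the pieces of a split word do not use initial segments of the
    naturals. *)
Definition words132 (V : seq nat) : seq (seq nat) :=
  [seq s <- permutations V | zigzag s && ~~ seq_contains [:: 1; 3; 2] s].

Definition words (V : seq nat) : seq (seq nat) :=
  [seq s <- permutations V | zigzag s && avoid_both s].

Lemma words132P V s :
  reflect [/\ perm_eq s V, zigzag s & ~~ seq_contains [:: 1; 3; 2] s]
          (s \in words132 V).
Proof.
rewrite mem_filter mem_permutations -andbA.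
by apply: (iffP and3P) => -[].
Qed.

Lemma wordsP V s :
  reflect [/\ perm_eq s V, zigzag s & avoid_both s] (s \in words V).
Proof.
rewrite mem_filter mem_permutations -andbA.
by apply: (iffP and3P) => -[].
Qed.

Lemma words132_uniq V : uniq (words132 V).
Proof. exact: filter_uniq (permutations_uniq V). Qed.

Lemma words_uniq V : uniq (words V).
Proof. exact: filter_uniq (permutations_uniq V). Qed.

(** Counting by a disjoint union: both recurrences below take for [F j] the words glued from pieces
    of prescribed sizes. *)
Lemma size_partition (T : eqType) (S : seq T) (k : nat) (F : nat -> seq T) :
  uniq S -> (forall j, j < k -> uniq (F j)) ->
  (forall x, x \in S <-> exists2 j, j < k & x \in F j) ->
  (forall i j x, i < k -> j < k -> x \in F i -> x \in F j -> i = j) ->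
  size S = \sum_(j < k) size (F j).
Proof.
move=> US UF SF D.
have /perm_size -> : perm_eq S (flatten [seq F j | j <- iota 0 k]).
  apply: uniq_perm => // [{US SF}|x].
    elim: k UF D => // k IH UF D.
    rewrite -addn1 iotaD map_cat flatten_cat /= cats0 cat_uniq IH ?UF //=; last 2 first.
    - by move=> j jk; apply: UF; lia.
    - by move=> i j x ik jk; apply: D; lia.
    rewrite andbT; apply/hasPn => x xk; apply/flatten_mapP => -[j].
    rewrite mem_iota => jk xj.
    by have := D k j x (ltnSn k) (ltac:(lia)) xk xj; lia.
  apply/idP/flatten_mapP => [/SF[j jk xj]|[j jk xj]].
    by exists j => //; rewrite mem_iota.
  by apply/SF; exists j => //; rewrite mem_iota in jk.
rewrite size_flatten /shape -map_comp sumnE big_map.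
by rewrite -(big_mkord xpredT (fun j => size (F j))) /index_iota subn0.
Qed.

(** The list [sort leq Q ++ sort leq P] is sorted and has the letters of [V], so it is [V]. *)
Lemma sorted_split V P Q : sorted ltn V -> perm_eq (P ++ Q) V ->
  {in P & Q, forall x y, y < x} ->
  perm_eq P (drop (size Q) V) /\ perm_eq Q (take (size Q) V).
Proof.
move=> sV pV PQ.
have -> : V = sort leq Q ++ sort leq P.
  apply: (sorted_eq leq_trans anti_leq).
  - by apply: sub_sorted sV => x y; apply: ltnW.
  - rewrite sorted_pairwise ?pairwise_cat -?sorted_pairwise ?sort_sorted //;
      [|exact: leq_total|exact: leq_total|exact: leq_trans..].
    rewrite !andbT; apply/allrelP => x y; rewrite !mem_sort => xQ yP.
    exact/ltnW/PQ.
  rewrite perm_sym in pV; apply: (perm_trans pV); rewrite perm_catC.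
  by apply: perm_cat; rewrite perm_sym perm_sort.
by rewrite take_size_cat ?drop_size_cat ?size_sort //; split;
  rewrite perm_sym perm_sort.
Qed.

Lemma sorted_take_drop V i x y : sorted ltn V ->
  x \in drop i V -> y \in take i V -> y < x.
Proof.
rewrite (sorted_pairwise ltn_trans) -{1}(cat_take_drop i V) pairwise_cat.
by move=> /andP[/allrelP h _] xd yt; apply: h.
Qed.

Lemma sorted_rcons_ltn V m : sorted ltn (rcons V m) ->
  sorted ltn V /\ {in V, forall x, x < m}.
Proof.
rewrite !(sorted_pairwise ltn_trans) pairwise_rcons => /andP[/allP h ->].
by split.
Qed.

Lemma mem_split (T : eqType) (x : T) s : x \in s -> exists P Q, s = P ++ x :: Q.
Proof. by case/splitPr => P Q; exists P, Q. Qed.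

Lemma perm_mid (T : eqType) (P Q V : seq T) m :
  perm_eq (P ++ m :: Q) (rcons V m) = perm_eq (P ++ Q) V.
Proof.
rewrite -cat_rcons -cats1 -catA perm_catCA -(cats1 V) perm_sym perm_catC /=.
by rewrite perm_cons perm_sym.
Qed.

(** * Decompositions at the largest letters and their recurrences *)

Lemma zigzag_max_split P m Q : {in P, forall x, x < m} -> {in Q, forall x, x < m} ->
  0 < size (P ++ Q) -> zigzag (P ++ m :: Q) ->
  [/\ P != [::], zigzag P & zigzag Q].
Proof.
move=> Pm Qm; case: (altP (P =P [::])) => [-> /=|P0 _].
  (* With [P] empty the word would begin with a descent from [m]. *)
  by case: Q Qm => [|x [|y Q]] // h _ /= /and3P[]; have := h x; rewrite mem_head; lia.
rewrite zigzag_cat //; first by case/and3P.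
by apply: Pm; case: P P0 => // x P _; apply: mem_last.
Qed.

(** Only the head of [Q] is bounded, since the pivot may also be the second largest letter, with the
    largest one inside [Q]. *)
Lemma zigzag_max_cat P m Q : {in P, forall x, x < m} -> head m Q < m ->
  zigzag P -> zigzag Q -> zigzag (P ++ m :: Q).
Proof.
move=> Pm Qm zP zQ; have P0 : P != [::] by case: P zP {Pm}.
rewrite zigzag_cat ?zP ?zQ ?Qm //.
by apply: Pm; case: P P0 {zP} => // x P _; apply: mem_last.
Qed.

(** Around the maximum [m], the right part has odd length [2 * j + 1] and takes the smallest
    letters; the left part takes the others. *)
Lemma words132_rec V m k : sorted ltn (rcons V m) -> size V = 2 * k.+1 ->
  size (words132 (rcons V m)) =
  \sum_(j < k.+1) size (words132 (drop (2 * j + 1) V)) *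
                  size (words132 (take (2 * j + 1) V)).
Proof.
move=> sVm szV; have [sV Vm] := sorted_rcons_ltn _ _ sVm.
have mV : m \notin V by apply/negP => /Vm; rewrite ltnn.
have Um : uniq (rcons V m) by exact: sorted_uniq ltn_trans ltnn _ sVm.
pose F j := [seq P ++ m :: Q | P <- words132 (drop (2 * j + 1) V),
                               Q <- words132 (take (2 * j + 1) V)].
rewrite (@size_partition _ _ k.+1 F).
- by apply: eq_bigr => j _; rewrite size_allpairs.
- exact: words132_uniq.
- move=> j _; apply: allpairs_uniq; rewrite ?words132_uniq //.
  move=> [P Q] [P' Q'] /allpairsP[[p q] /= [/words132P[pp _ _] _ [-> ->]]].
  move=> /allpairsP[[p' q'] /= [/words132P[pp' _ _] _ [-> ->]]] e.
  have := @cat_mid_inj _ m p p' q q'.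
  rewrite (perm_mem pp) (perm_mem pp') e.
  have -> : m \notin drop (2 * j + 1) V by apply: contra mV; apply: mem_drop.
  by case=> // -> ->.
- move=> s; split.
  + move=> /words132P[ps zs avs].
    have /mem_split[P [Q es]] : m \in s by rewrite (perm_mem ps) mem_rcons mem_head.
    subst s; have pV := ps; rewrite perm_mid in pV.
    have Pm : {in P, forall x, x < m}.
      by move=> x xP; apply: Vm; rewrite -(perm_mem pV) mem_cat xP.
    have Qm : {in Q, forall x, x < m}.
      by move=> x xQ; apply: Vm; rewrite -(perm_mem pV) mem_cat xQ orbT.
    have [|_ zP zQ] := zigzag_max_split P m Q Pm Qm _ zs.
      by rewrite (perm_size pV) szV.
    have PQ : {in P & Q, forall x y, y < x}.
      by apply: avoid132_gt avs => //; rewrite (perm_uniq ps).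
    have [pP pQ] := sorted_split V P Q sV pV PQ.
    have oP := zigzag_odd _ zP; have oQ := zigzag_odd _ zQ.
    have := perm_size pV; rewrite size_cat szV => szPQ.
    have eQ : size Q = 2 * (size Q)./2 + 1 by lia.
    exists (size Q)./2; first by lia.
    apply/allpairsP; exists (P, Q); split=> //=; apply/words132P; rewrite -eQ; split=> //.
      by apply: avoid132_sub avs; apply: prefix_subseq.
    apply: avoid132_sub avs; apply: subseq_trans (suffix_subseq P _).
    exact: subseq_cons.
  move=> [j jk /allpairsP[[P Q] /= [/words132P[pP zP aP] /words132P[pQ zQ aQ] ->]]].
  have Pm : {in P, forall x, x < m}.
    by move=> x xP; apply: Vm; apply: (@mem_drop (2 * j + 1)); rewrite -(perm_mem pP).
  have Qm : {in Q, forall x, x < m}.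
    by move=> x xQ; apply: Vm; apply: (@mem_take (2 * j + 1)); rewrite -(perm_mem pQ).
  apply/words132P; split.
  + rewrite perm_mid -[V in perm_eq _ V](cat_take_drop (2 * j + 1)) perm_catC.
    exact: perm_cat.
  + apply: zigzag_max_cat => //; case: Q zQ Qm {pQ aQ} => // y Q _ /=; apply.
    exact: mem_head.
  apply: avoid132_cat => // x y xP yQ; apply: (@sorted_take_drop V (2 * j + 1)) => //.
    by rewrite -(perm_mem pP).
  by rewrite -(perm_mem pQ).
(* The length of the part before [m] determines the index. *)
move=> i j s ik jk /allpairsP[[P Q] /= [/words132P[pP _ _] _ ->]].
move=> /allpairsP[[P' Q'] /= [/words132P[pP' _ _] _]] /cat_mid_inj[].
- by rewrite (perm_mem pP); apply: contra mV; apply: mem_drop.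
- by rewrite (perm_mem pP'); apply: contra mV; apply: mem_drop.
move=> e _; have := perm_size pP; rewrite e (perm_size pP') !size_drop szV; lia.
Qed.

Lemma left_of_max (m' m : nat) L R : m \notin L -> m' != m ->
  (index m' (L ++ m :: R) < index m (L ++ m :: R)) = (m' \in L).
Proof.
move=> mL ne; rewrite !index_cat (negPf mL) /= eqxx addn0 eq_sym (negPf ne).
by case: ifP => [|_]; [rewrite index_mem|lia].
Qed.

(** Reversal is a bijection between the words with [m'] before [m] and those with [m'] after [m]. *)
Lemma words_half (V : seq nat) (m' m : nat) : m' \in V -> m \in V -> m' != m -> uniq V ->
  size (words V) = 2 * size [seq s <- words V | index m' s < index m s].
Proof.
move=> m'V mV ne UV; pose left s := index m' s < index m s.
have mrev s : s \in words V -> rev s \in words V.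
  move=> /wordsP[ps zs avs]; apply/wordsP; split.
  - by rewrite perm_rev.
  - exact: zigzag_rev.
  exact: avoid_both_rev.
have pr : perm_eq (words V) [seq rev s | s <- words V].
  apply: uniq_perm; rewrite ?words_uniq ?(map_inj_uniq (can_inj revK)) ?words_uniq //.
  move=> s; apply/idP/mapP => [sV|[t tV ->]]; last exact: mrev.
  by exists (rev s); rewrite ?revK ?mrev.
rewrite size_filter -/left -(count_predC left) mul2n -addnn; congr (_ + _).
rewrite (seq.permP pr) count_map; apply: eq_in_count => s /wordsP[ps _ _] /=.
have Us : uniq s by rewrite (perm_uniq ps).
have /mem_split[L [R es]] : m \in s by rewrite (perm_mem ps).
have m's : m' \in s by rewrite (perm_mem ps).
move: Us m's; rewrite es cat_uniq mem_cat inE (negPf ne) /= => /and3P[_ + /andP[mR _]].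
rewrite negb_or => /andP[mL /hasPn LR] m's.
rewrite /left rev_cat rev_cons cat_rcons !left_of_max ?mem_rev //.
by case: (boolP (m' \in R)) m's => [/LR /negPf -> //|_]; rewrite orbF => ->.
Qed.

(** The first term counts the words [m' m R]. Term [j] counts the words [P m' Q] with [P] of length
    [2 * j + 1] on the largest letters of [W], and [Q] on the remaining ones together with [m]. *)
Lemma words_left_rec W m' m n : sorted ltn (rcons (rcons W m') m) ->
  size W = 2 * n + 1 ->
  size [seq s <- words (rcons (rcons W m') m) | index m' s < index m s] =
  size (words W) +
  \sum_(j < n) size (words132 (drop (2 * (n - j)) W)) *
               size (words (rcons (take (2 * (n - j)) W) m)).
Proof.
move=> sV szW; have [sWm' Vm] := sorted_rcons_ltn _ _ sV.
have [sW Wm'] := sorted_rcons_ltn _ _ sWm'.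
have mm : m' < m by apply: Vm; rewrite mem_rcons mem_head.
have Wm : {in W, forall x, x < m} by move=> x /Wm'; lia.
have mW : m \notin W by apply/negP => /Wm; rewrite ltnn.
have m'W : m' \notin W by apply/negP => /Wm'; rewrite ltnn.
have ne : m' != m by lia.
have UV : uniq (rcons (rcons W m') m) by exact: sorted_uniq ltn_trans ltnn _ sV.
pose F j := if j is j'.+1 then
    [seq P ++ m' :: Q | P <- words132 (drop (2 * (n - j')) W),
                        Q <- words (rcons (take (2 * (n - j')) W) m)]
  else [seq [:: m', m & R] | R <- words W].
have permV P Q : perm_eq (P ++ m' :: Q) (rcons (rcons W m') m)
               = perm_eq (P ++ Q) (rcons W m).
  rewrite -(perm_mid _ P Q _ m').
  have /seq.permPr -> // : perm_eq (rcons (rcons W m') m) (rcons (rcons W m) m').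
  by rewrite -!cats1 -!catA perm_cat2l (perm_catC [:: m']).
rewrite (@size_partition _ _ n.+1 F).
- by rewrite big_ord_recl /F size_map; congr (_ + _); apply: eq_bigr => j _; rewrite size_allpairs.
- exact/filter_uniq/words_uniq.
- case=> [_|j _] /=; first by rewrite map_inj_uniq ?words_uniq // => x y [].
  apply: allpairs_uniq; rewrite ?words132_uniq ?words_uniq //.
  move=> [P Q] [P' Q'] /allpairsP[[p q] /= [/words132P[pp _ _] _ [-> ->]]].
  move=> /allpairsP[[p' q'] /= [/words132P[pp' _ _] _ [-> ->]]] e.
  have := @cat_mid_inj _ m' p p' q q'.
  rewrite (perm_mem pp) (perm_mem pp') e.
  have -> : m' \notin drop (2 * (n - j)) W by apply: contra m'W; apply: mem_drop.
  by case=> // -> ->.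
- move=> s; rewrite mem_filter; split.
  + move=> /andP[lft /wordsP[ps zs avs]].
    have Us : uniq s by rewrite (perm_uniq ps).
    have /mem_split[L [R es]] : m \in s by rewrite (perm_mem ps) mem_rcons mem_head.
    have mL : m \notin L.
      move: Us; rewrite es cat_uniq => /and3P[_ /hasPn h _].
      by apply: h; rewrite mem_head.
    move: lft; rewrite es left_of_max // => /mem_split[P [Q' eL]].
    subst s L; move: ps zs avs Us; rewrite -catA /= => ps zs avs Us.
    have pW : perm_eq (P ++ Q' ++ R) W.
      by move: ps; rewrite permV catA perm_mid catA.
    have inW x : x \in P ++ Q' ++ R -> x < m' by rewrite (perm_mem pW) => /Wm'.
    have Pm : {in P, forall x, x < m'} by move=> x xP; apply: inW; rewrite mem_cat xP.
    have Qm : {in Q', forall x, x < m'}.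
      by move=> x xP; apply: inW; rewrite !mem_cat xP orbT.
    have Rm : {in R, forall x, x < m'}.
      by move=> x xP; apply: inW; rewrite !mem_cat xP !orbT.
    have [||||_ zL zR] := zigzag_max_split (P ++ m' :: Q') m R.
    * by move=> x; rewrite mem_cat inE => /or3P[/Pm h|/eqP h|/Qm h]; clear -h mm; lia.
    * by move=> x /Rm h; clear -h mm; lia.
    * by rewrite !size_cat /= addnS.
    * by rewrite -catA.
    case: (altP (P =P [::])) => [eP|P0].
      exists 0 => //; subst P; case: Q' Qm zs ps {pW inW Us avs zL mL} (avs) => [|y Q'] Qm zs ps avs.
        apply/mapP; exists R => //; apply/wordsP; split=> //.
          by move: ps; rewrite (permV [::]) (perm_mid _ [::]).
        apply: avoid_both_sub avs; exact: subseq_trans (subseq_cons _ m) (subseq_cons _ m').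
      (* The word would begin with the descent from [m'] to [y]. *)
      exfalso; have := Qm y (mem_head _ _); have := zigzag_head _ zs isT => /=; clear; lia.
    have lP : last 0 P < m' by apply: Pm; case: (P) P0 => // x P1 _; apply: mem_last.
    have := zs; rewrite zigzag_cat // => /and3P[zP zQ _].
    have R0 : R != [::] by case: (R) zR.
    have [PQ aP] := avoid_both_split P m' Q' m R Us R0 mm Pm Qm Rm avs.
    (* Once [m] is removed no exception remains, so [W] splits into an upper block [P] and a lower
       block. *)
    have PQ' : {in P & Q' ++ R, forall x y, y < x}.
      move=> x y xP yQ; have := PQ x y xP; rewrite !mem_cat inE in yQ *.
      have : y < m' by apply: inW; rewrite mem_cat mem_cat yQ orbT.
      by case/orP: yQ => -> ; rewrite ?orbT /= => h /(_ isT); clear -h mm; lia.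
    have [pP pQ] := sorted_split W P (Q' ++ R) sW pW PQ'.
    have oP := zigzag_odd _ zP; have oQ := zigzag_odd _ zQ.
    have := perm_size pW; rewrite !size_cat szW => szPQ.
    rewrite size_cat /= in oQ.
    have sR : 0 < size R by case: (R) R0.
    have eQ : size (Q' ++ R) = 2 * (n - (size P)./2) by rewrite size_cat; clear -oP oQ szPQ; lia.
    exists ((size P)./2.+1); first by clear -oP oQ szPQ sR; lia.
    apply/allpairsP; exists (P, Q' ++ m :: R); split=> //=.
      by apply/words132P; rewrite -eQ.
    apply/wordsP; split; rewrite // -?eQ ?perm_mid //.
    apply: avoid_both_sub avs; apply: subseq_trans (suffix_subseq P _).
    exact: subseq_cons.
  case=> -[_ /mapP[R /wordsP[pR zR aR] ->]|j jn /allpairsP[[P Q] /=]].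
    have Rm : {in R, forall x, x < m'} by move=> x; rewrite (perm_mem pR) => /Wm'.
    rewrite /= !eqxx (negPf ne) /=; apply/wordsP; split.
    * by rewrite (permV [::]) (perm_mid _ [::]).
    * case: R zR Rm {pR aR} => //= x R -> Rm; rewrite mm andbT /=.
      by have := Rm x (mem_head _ _); clear -mm; lia.
    exact: avoid_both_cons2.
  move=> [/words132P[pP zP aP] /wordsP[pQ zQ aQ] ->].
  have PW x : x \in P -> x \in W by rewrite (perm_mem pP); apply: mem_drop.
  have QW y : y \in Q -> y = m \/ y \in take (2 * (n - j)) W.
    by rewrite (perm_mem pQ) mem_rcons inE => /orP[/eqP ->|]; [left|right].
  have Pm : {in P, forall x, x < m'} by move=> x /PW /Wm'.
  have Qm : {in Q, forall x, x < m' \/ x = m}.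
    by move=> x /QW[->|/mem_take /Wm']; [right|left].
  have mP : m' \notin P by apply: contra m'W; apply: PW.
  have mP' : m \notin P by apply: contra mW; apply: PW.
  have m'Q : m' \notin Q.
    apply/negP => /QW[e|]; first by rewrite e eqxx in ne.
    by move/mem_take; rewrite (negPf m'W).
  have ps : perm_eq (P ++ m' :: Q) (rcons (rcons W m') m).
    rewrite permV; apply: (@perm_trans _ (P ++ rcons (take (2 * (n - j)) W) m)).
      by rewrite perm_cat2l.
    rewrite -!cats1 catA perm_cat2r perm_sym -{1}(cat_take_drop (2 * (n - j)) W).
    by rewrite perm_catC perm_cat2r perm_sym.
  apply/andP; split.
    by rewrite !index_cat (negPf mP) (negPf mP') /= eqxx (negPf ne) addn0 addnS ltnS leq_addr.
  apply/wordsP; split=> //.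
    apply: zigzag_max_cat => //.
    (* As [Q] begins with an ascent, its head is not [m], hence lies below [m']. *)
    have szQ : 2 < size Q.
      by rewrite (perm_size pQ) size_rcons size_takel ?szW; clear -jn; lia.
    have := zigzag_head _ zQ (ltnW szQ).
    have := Qm (head 0 Q); have := Qm (nth 0 Q 1).
    rewrite -nth0 !mem_nth ?(ltnW szQ) ?(ltnW (ltnW szQ)) // => /(_ isT) h1 /(_ isT) h0 h.
    by case: (Q) szQ h1 h0 h => //= x Q1 _ h1 h0 h; clear -h1 h0 h mm; lia.
  apply: (@avoid_both_cat P m' m Q) => //; first by rewrite (perm_uniq ps).
  move=> x y; rewrite (perm_mem pP) => xP /QW[->|yQ]; [by right|left].
  exact: sorted_take_drop xP yQ.
(* Words of [F 0] begin with [m']; the others begin with a letter of the nonempty [P], taken from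
   [W]. *)
have dis s : s \in F 0 -> forall j, j < n -> s \in F j.+1 -> False.
  move=> /mapP[R _ ->] j jn /allpairsP[[P Q] /= [/words132P[pP zP _] _ e]].
  case: P e pP zP => // x P [<- _] /perm_mem /(_ m').
  by rewrite mem_head => /esym /mem_drop; rewrite (negPf m'W).
move=> [|i] [|j] s ik jk // h1 h2.
- by case: (dis s h1 j jk h2).
- by case: (dis s h2 i ik h1).
move: h1 h2 => /allpairsP[[P Q] /= [/words132P[pP _ _] _ ->]].
move=> /allpairsP[[P' Q'] /= [/words132P[pP' _ _] _]] /cat_mid_inj[].
- by rewrite (perm_mem pP); apply: contra m'W; apply: mem_drop.
- by rewrite (perm_mem pP'); apply: contra m'W; apply: mem_drop.
move=> e _; have := perm_size pP; rewrite e (perm_size pP') !size_drop szW; clear -ik jk; lia.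
Qed.

(** * Numerical recurrences, independent of the alphabet *)

Lemma words132_1 x : size (words132 [:: x]) = 1.
Proof.
rewrite (@perm_size _ _ [:: [:: x]]) //; apply: uniq_perm => //.
  exact: words132_uniq.
move=> s; rewrite inE; apply/words132P/eqP => [[/perm_small_eq -> //]|->].
split=> //; apply/avoid132P => a b c /mem_subseq h ab bc.
by have := h a; have := h b; rewrite !inE !eqxx !orbT => /(_ isT) /eqP ? /(_ isT) /eqP; lia.
Qed.

Lemma words_1 x : size (words [:: x]) = 1.
Proof.
rewrite (@perm_size _ _ [:: [:: x]]) //; apply: uniq_perm => //.
  exact: words_uniq.
move=> s; rewrite inE; apply/wordsP/eqP => [[/perm_small_eq -> //]|->].
split=> //; apply/andP; split; [apply/avoid1342P|apply/avoid2431P];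
  move=> a b c d /mem_subseq h ab bc;
  by have := h a; have := h b; rewrite !inE !eqxx !orbT => /(_ isT) /eqP ? /(_ isT) /eqP; lia.
Qed.

(** The Catalan numbers, as the recurrence below shows. *)
Definition count132 (k : nat) : nat := size (words132 (iota 0 (2 * k + 1))).
Definition altcount (n : nat) : nat := size (words (iota 0 (2 * n + 1))).

Lemma take_sorted_ltn V i : sorted ltn V -> sorted ltn (take i V).
Proof. exact: (subseq_sorted ltn_trans (take_subseq _ _)). Qed.

Lemma drop_sorted_ltn V i : sorted ltn V -> sorted ltn (drop i V).
Proof. exact: (subseq_sorted ltn_trans (drop_subseq _ _)). Qed.

(** Independence of the alphabet and the recurrence are proved together: the recurrence for an
    arbitrary [V] needs the independence for shorter alphabets, and comparing [V] with the standard
    alphabet yields it for the next length. *)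
Lemma size_words132 k V : sorted ltn V -> size V = 2 * k + 1 ->
  size (words132 V) = count132 k /\
  (0 < k -> size (words132 V) = \sum_(j < k) count132 (k.-1 - j) * count132 j).
Proof.
elim/ltn_ind: k V => -[_ [|x [|y V]] // _|k IH].
  by move=> _; rewrite words132_1 /count132 words132_1.
have IH1 i V : i < k.+1 -> sorted ltn V -> size V = 2 * i + 1 ->
    size (words132 V) = count132 i by move=> ik sV szV; case: (IH i ik V sV szV).
have rec V : sorted ltn V -> size V = 2 * k.+1 + 1 ->
    size (words132 V) = \sum_(j < k.+1) count132 (k - j) * count132 j.
  case/lastP: V => [|V m]; first by move=> _ /=; lia.
  rewrite size_rcons => sV szV; have [sV' _] := sorted_rcons_ltn _ _ sV.
  have szV' : size V = 2 * k.+1 by lia.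
  rewrite (words132_rec _ _ _ sV szV'); apply: eq_bigr => j _; have jk := ltn_ord j.
  congr (_ * _).
    by apply: (IH1 (k - j)); [lia|exact: drop_sorted_ltn|rewrite size_drop; lia].
  by apply: (IH1 j); [lia|exact: take_sorted_ltn|rewrite size_takel; lia].
move=> V sV szV; rewrite rec //; split=> //.
by apply/esym/rec; rewrite ?size_iota ?iota_ltn_sorted.
Qed.

Lemma count132_0 : count132 0 = 1.
Proof. exact: words132_1. Qed.

Lemma count132_rec k : count132 k.+1 = \sum_(j < k.+1) count132 (k - j) * count132 j.
Proof.
by apply: (size_words132 k.+1 (iota 0 (2 * k.+1 + 1)) _ _).2;
  rewrite ?size_iota ?iota_ltn_sorted.
Qed.

Lemma size_words n V : sorted ltn V -> size V = 2 * n + 1 ->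
  size (words V) = altcount n /\
  (0 < n -> size (words V) =
     2 * (altcount n.-1 + \sum_(j < n.-1) count132 j * altcount (n.-1 - j))).
Proof.
elim/ltn_ind: n V => -[_ [|x [|y V]] // _|n IH].
  by move=> _; rewrite words_1 /altcount words_1.
have IH1 i V : i < n.+1 -> sorted ltn V -> size V = 2 * i + 1 ->
    size (words V) = altcount i by move=> ik sV szV; case: (IH i ik V sV szV).
have rec V : sorted ltn V -> size V = 2 * n.+1 + 1 -> size (words V) =
     2 * (altcount n + \sum_(j < n) count132 j * altcount (n - j)).
  case/lastP: V => [|V m]; first by move=> _ /=; lia.
  case/lastP: V => [|W m']; first by move=> _ /=; lia.
  rewrite !size_rcons => sV szV; have [sV' Vm] := sorted_rcons_ltn _ _ sV.
  have [sW _] := sorted_rcons_ltn _ _ sV'.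
  have szW : size W = 2 * n + 1 by lia.
  have mm : m' < m by apply: Vm; rewrite mem_rcons mem_head.
  rewrite (@words_half _ m' m); last first.
  - exact: sorted_uniq ltn_trans ltnn _ sV.
  - by rewrite neq_ltn mm.
  - by rewrite mem_rcons mem_head.
  - by rewrite mem_rcons inE mem_rcons mem_head orbT.
  rewrite (words_left_rec _ _ _ _ sV szW); congr (_ * (_ + _)).
    by apply: (IH1 n).
  apply: eq_bigr => j _; have jn := ltn_ord j; congr (_ * _).
    case: (@size_words132 j (drop (2 * (n - j)) W)) => //.
      exact: drop_sorted_ltn.
    by rewrite size_drop; lia.
  apply: (IH1 (n - j)); [lia| |by rewrite size_rcons size_takel; lia].
  apply: (subseq_sorted ltn_trans) sV; rewrite -!cats1; apply: cat_subseq => //.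
  exact: subseq_trans (take_subseq _ _) (prefix_subseq _ _).
move=> V sV szV; rewrite rec //; split=> //.
by apply/esym/rec; rewrite ?size_iota ?iota_ltn_sorted.
Qed.

Lemma altcount_0 : altcount 0 = 1.
Proof. exact: words_1. Qed.

Lemma altcount_rec n : altcount n.+1 =
  2 * (altcount n + \sum_(j < n) count132 j * altcount (n - j)).
Proof.
by apply: (size_words n.+1 (iota 0 (2 * n.+1 + 1)) _ _).2;
  rewrite ?size_iota ?iota_ltn_sorted.
Qed.

(** * From permutations to words *)

Definition word {m} (pi : 'S_m) : seq nat := [seq val (pi i) | i <- enum 'I_m].

Lemma size_word m (pi : 'S_m) : size (word pi) = m.
Proof. by rewrite size_map size_enum_ord. Qed.

Lemma nth_word {m} (pi : 'S_m) (i : 'I_m) : nth 0 (word pi) i = pi i.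
Proof. by rewrite (nth_map i) ?size_enum_ord // nth_ord_enum. Qed.

Lemma word_inj m : injective (@word m).
Proof.
by move=> p q e; apply/permP => i; apply: val_inj; rewrite /= -!nth_word e.
Qed.

Lemma perm_word m (pi : 'S_m) : perm_eq (word pi) (iota 0 m).
Proof.
rewrite -val_enum_ord /word (map_comp val pi); apply: perm_map.
apply: uniq_perm; rewrite ?(map_inj_uniq perm_inj) ?enum_uniq // => i.
by rewrite mem_enum; apply/mapP; exists (pi^-1%g i); rewrite ?mem_enum // permKV.
Qed.

Lemma word_surj {m} (s : seq nat) : perm_eq s (iota 0 m) -> exists pi : 'S_m, s = word pi.
Proof.
move=> ps; have szs : size s = m by rewrite (perm_size ps) size_iota.
have lts (i : 'I_m) : nth 0 s i < m.
  have : nth 0 s i \in iota 0 m by rewrite -(perm_mem ps) mem_nth ?szs.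
  by rewrite mem_iota.
have inj : injective (fun i : 'I_m => Ordinal (lts i)).
  move=> i j [] /eqP; rewrite nth_uniq ?szs ?(perm_uniq ps) ?iota_uniq //.
  by move/eqP/val_inj.
exists (perm inj); apply: (@eq_from_nth _ 0); rewrite ?size_word // => i.
by rewrite szs => im; rewrite (nth_word (perm inj) (Ordinal im)) permE.
Qed.

(** Positions count from 0, as in [alternating]; the parity clause is the one built into
    [zigzag]. *)
Lemma zigzagP s : reflect
  (odd (size s) /\ forall i, i.+1 < size s ->
     if odd i then nth 0 s i.+1 < nth 0 s i else nth 0 s i < nth 0 s i.+1)
  (zigzag s).
Proof.
suff H : zigzag s <-> (odd (size s) /\ forall i, i.+1 < size s ->
     if odd i then nth 0 s i.+1 < nth 0 s i else nth 0 s i < nth 0 s i.+1).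
  by apply: (iffP idP) => /H.
case: s => [|x s]; first by split=> // -[].
elim/seq_pair_ind: s x => [|y|y z s IH] x.
- by split=> // _; split=> // -[].
- by split=> // -[].
split=> [/and3P[xy zy /IH[o h]]|[o h]].
  split; first by move: o => /=; rewrite !negbK.
  by move=> [|[|i]] //= hi; rewrite negbK; apply: (h i).
apply/and3P; split; first exact: (h 0).
  exact: (h 1).
apply/IH; split; first by move: o => /=; rewrite !negbK.
by move=> i hi; have := h i.+2 hi; rewrite /= negbK.
Qed.

Lemma alternating_word m (pi : 'S_m) : odd m -> alternating pi = zigzag (word pi).
Proof.
move=> om; apply/'forall_forallP/zigzagP; rewrite size_word.
  move=> h; split=> // i im; have im' := ltnW im.
  have := h (Ordinal im') (Ordinal im); rewrite /= eqxx /=.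
  by rewrite -(nth_word pi (Ordinal im)) -(nth_word pi (Ordinal im')).
move=> [_ h] i j; apply/implyP => /eqP e.
by have := h i; rewrite -e ltn_ord !nth_word => /(_ isT).
Qed.

(** An embedding of positions corresponds to an increasing list [is_] of positions, that is, to a
    subsequence of [iota 0 m]; reading the word there gives the occurrence. *)
Lemma contains_word p m (pi : 'S_m) : contains p pi = seq_contains p (word pi).
Proof.
apply/existsP/seq_containsP => [[f /'forall_forallP h]|[t st]].
  pose is_ := [seq val (f a) | a <- enum 'I_(size p)].
  have sis : size is_ = size p by rewrite size_map size_enum_ord.
  have nis (a : 'I_(size p)) : nth 0 is_ a = f a.
    by rewrite (nth_map a) ?size_enum_ord // nth_ord_enum.
  exists [seq nth 0 (word pi) i | i <- is_].
    have {2}-> : word pi = [seq nth 0 (word pi) i | i <- iota 0 m].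
      by rewrite -[LHS](mkseq_nth 0) size_word.
    apply: map_subseq.
    have so : sorted ltn is_.
      apply/(sortedP 0) => i; rewrite sis => ip.
      rewrite (nis (Ordinal ip)) (nis (Ordinal (ltnW ip))).
      by have /andP[/implyP + _] := h (Ordinal (ltnW ip)) (Ordinal ip); apply.
    have -> : is_ = [seq i <- iota 0 m | i \in is_].
      apply: (irr_sorted_eq ltn_trans ltnn) => //.
        exact: (sorted_filter ltn_trans _ (iota_ltn_sorted _ _)).
      move=> i; rewrite mem_filter mem_iota /= add0n.
      by case: (boolP (i \in is_)) => // /mapP[a _ ->] /=; rewrite ltn_ord.
    exact: filter_subseq.
  rewrite /order_iso size_map sis eqxx /=.
  apply/allP => a; rewrite mem_iota => /= ap; apply/allP => b; rewrite mem_iota => /= bp.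
  rewrite !(nth_map 0) ?sis //.
  rewrite (nis (Ordinal ap)) (nis (Ordinal bp)) !nth_word.
  by have /andP[] := h (Ordinal ap) (Ordinal bp).
move=> /andP[/eqP szt /allP it].
have [is_ so et] : exists2 is_, subseq is_ (iota 0 m) & t = [seq nth 0 (word pi) i | i <- is_].
  move: st; have {1}-> : word pi = [seq nth 0 (word pi) i | i <- iota 0 m].
    by rewrite -[LHS](mkseq_nth 0) size_word.
  case/subseqP => k sk ->; exists (mask k (iota 0 m)); first exact: mask_subseq.
  by rewrite map_mask.
have sis : size is_ = size p by rewrite -szt et size_map.
have lt (a : 'I_(size p)) : nth 0 is_ a < m.
  have : nth 0 is_ a \in iota 0 m by apply: (mem_subseq so); rewrite mem_nth ?sis.
  by rewrite mem_iota.
exists [ffun a => Ordinal (lt a)]; apply/'forall_forallP => a b; rewrite !ffunE.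
apply/andP; split.
  apply/implyP => ab /=.
  have sl : sorted ltn is_ := subseq_sorted ltn_trans so (iota_ltn_sorted 0 m).
  by apply: (sorted_ltn_nth ltn_trans 0 sl); rewrite ?inE ?sis.
have /allP := it a (ltac:(by rewrite mem_iota /=)).
move=> /(_ b); rewrite mem_iota /= ltn_ord => /(_ isT).
by rewrite et !(nth_map 0) ?sis // (nth_word pi (Ordinal (lt a))) (nth_word pi (Ordinal (lt b))).
Qed.

Lemma u_altcount n : u n = altcount n.
Proof.
rewrite /u /alt_avoid_count /altcount; set m := 2 * n + 1.
have om : odd m by rewrite /m; lia.
set A := [set _ | _]; rewrite cardE -(size_map (@word m)).
apply: perm_size; apply: uniq_perm.
- by rewrite (map_inj_uniq (word_inj m)) enum_uniq.
- exact: words_uniq.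
have memA pi : (pi \in A) = zigzag (word pi) && avoid_both (word pi).
  by rewrite inE alternating_word // /avoids !contains_word.
move=> s; apply/mapP/wordsP => [[pi]|[ps zs avs]].
  by rewrite mem_enum memA => /andP[z av] ->; split=> //; apply: perm_word.
have [pi es] := word_surj _ ps.
by exists pi => //; rewrite mem_enum memA -es zs.
Qed.

(** * Formal power series *)

Local Open Scope ring_scope.

Lemma series_ext (a b : series) : a =1 b -> a = b.
Proof. exact: functional_extensionality. Qed.

(** Coefficient [n] of a product involves only coefficients up to [n], so commutativity and
    associativity of [smul] can be imported from truncations to polynomials. *)
Lemma coefM_smul (p q : {poly rat}) (a b : series) n :
  (forall i, (i <= n)%N -> p`_i = a i) -> (forall i, (i <= n)%N -> q`_i = b i) ->
  (p * q)`_n = smul a b n.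
Proof.
move=> pa qb; rewrite coefM; apply: eq_bigr => i _.
by rewrite pa ?qb ?leq_subr // -ltnS.
Qed.

Lemma coef_trunc (a : series) n i : (i <= n)%N -> (\poly_(j < n.+1) a j)`_i = a i.
Proof. by rewrite coef_poly ltnS => ->. Qed.

Lemma smulC a b : smul a b = smul b a.
Proof.
apply: series_ext => n.
by rewrite -!(coefM_smul _ _ _ _ _ (@coef_trunc _ n) (@coef_trunc _ n)) mulrC.
Qed.

Lemma smulA a b c : smul a (smul b c) = smul (smul a b) c.
Proof.
apply: series_ext => n.
have trunc_mul x y i : (i <= n)%N ->
    (\poly_(j < n.+1) x j * \poly_(j < n.+1) y j)`_i = smul x y i.
  move=> le_in; apply: coefM_smul => k ki; apply: coef_trunc;
    exact: leq_trans ki le_in.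
rewrite -(coefM_smul _ _ _ _ _ (@coef_trunc _ n) (trunc_mul b c)).
by rewrite -(coefM_smul _ _ _ _ _ (trunc_mul a b) (@coef_trunc _ n)) mulrA.
Qed.

Lemma smul1s a : smul sone a = a.
Proof.
apply: series_ext => n; rewrite /smul big_ord_recl big1 ?addr0 ?subn0 ?mul1r //.
by move=> i _; rewrite mul0r.
Qed.

Lemma smulDl a b c : smul (sadd a b) c = sadd (smul a c) (smul b c).
Proof.
apply: series_ext => n; rewrite /sadd /smul -big_split.
by apply: eq_bigr => i _; rewrite mulrDl.
Qed.

Lemma series_ring_theory :
  ring_theory (sconst 0) sone sadd smul ssub sopp (@eq series).
Proof.
split.
- by move=> a; apply: series_ext => -[|n]; apply: add0r.
- by move=> a b; apply: series_ext => n; apply: addrC.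
- by move=> a b c; apply: series_ext => n; apply: addrA.
- exact: smul1s.
- exact: smulC.
- exact: smulA.
- exact: smulDl.
- by [].
- by move=> a; apply: series_ext => -[|n]; apply: addrN.
Qed.

Add Ring series_ring : series_ring_theory.

Lemma sscale2 a : sscale 2 a = sadd a a.
Proof. by apply: series_ext => n; rewrite /sscale mulr_natl mulr2n. Qed.

Lemma sscale1 a : sscale 1 a = a.
Proof. by apply: series_ext => n; rewrite /sscale mul1r. Qed.

Lemma sscale4 a : sscale 4 a = sadd (sadd a a) (sadd a a).
Proof.
apply: series_ext => n.
by rewrite /sscale /sadd -!mulr2n -mulrnA mulr_natl.
Qed.

Lemma smulX0 a : smul sX a 0%N = 0.
Proof. by rewrite /smul big_ord1 mul0r. Qed.

Lemma smulXS a n : smul sX a n.+1 = a n.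
Proof.
rewrite /smul 2!big_ord_recl big1 ?addr0 /= ?mul0r ?add0r ?mul1r.
  by rewrite subSS subn0.
by move=> i _; rewrite mul0r.
Qed.

Lemma size_inv_upto a n : size (inv_upto a n) = n.+1.
Proof. by elim: n => //= n IH; rewrite size_rcons IH. Qed.

Lemma nth_inv_upto a n i : (i <= n)%N -> nth 0 (inv_upto a n) i = sinv a i.
Proof.
elim: n => [|n IH]; first by case: i.
rewrite leq_eqVlt => /orP[/eqP -> //|]; rewrite ltnS => le_in /=.
by rewrite nth_rcons size_inv_upto ltnS le_in IH.
Qed.

Lemma sinvS a n :
  sinv a n.+1 = - (a 0%N)^-1 * \sum_(k < n.+1) a k.+1 * sinv a (n - k)%N.
Proof.
rewrite {1}/sinv /= nth_rcons size_inv_upto ltnn eqxx; congr (_ * _).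
by apply: eq_bigr => k _; rewrite nth_inv_upto ?leq_subr.
Qed.

Lemma smul_sinv a : a 0%N != 0 -> smul a (sinv a) = sone.
Proof.
move=> a0; apply: series_ext => -[|n]; first by rewrite /smul big_ord1 divff.
rewrite /smul big_ord_recl subn0 sinvS mulrA mulrN divff // mulN1r.
by apply/eqP; rewrite addrC subr_eq0.
Qed.

Lemma sinv_unique a b : a 0%N != 0 -> smul b a = sone -> b = sinv a.
Proof.
move=> a0 ba; have e := smul_sinv a a0.
transitivity (smul b (smul a (sinv a))); first by rewrite e; ring.
by rewrite smulA ba; ring.
Qed.

(** Inversion preserves agreement up to order [n]; this carries the approximation through one level
    of the continued fraction. *)
Lemma sinv_eq_upto a b n : (forall i, (i <= n)%N -> a i = b i) ->
  forall i, (i <= n)%N -> sinv a i = sinv b i.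
Proof.
move=> ab; elim/ltn_ind => -[|i] IH le_in; first by rewrite /sinv /= ab.
rewrite !sinvS ab //; congr (_ * _); apply: eq_bigr => k _.
have lek : (k <= i)%N by rewrite -ltnS.
rewrite ab; last exact: leq_trans le_in.
by rewrite IH ?ltnS ?leq_subr //; apply: leq_trans le_in; rewrite ltnW // ltnS leq_subr.
Qed.

(** * Functional equations, the square root and the continued fraction *)

Definition catalan_series : series := fun n => (count132 n)%:R.
Definition root_series : series :=
  ssub sone (sscale 2 (smul sX catalan_series)).

Lemma catalan_eq : catalan_series =
  sadd sone (smul sX (smul catalan_series catalan_series)).
Proof.
apply: series_ext => -[|n]; rewrite /sadd ?smulX0 ?smulXS.
  by rewrite /catalan_series count132_0 addr0.
rewrite /catalan_series count132_rec natr_sum add0r.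
by apply: eq_bigr => j _; rewrite natrM mulrC.
Qed.

Lemma U_eq : U = sadd sone (sadd (sscale 2 (smul sX U))
  (sscale 2 (smul sX (smul catalan_series (ssub U sone))))).
Proof.
apply: series_ext => -[|n]; rewrite /sadd /sscale ?smulX0 ?smulXS.
  by rewrite /U u_altcount altcount_0 !mulr0 !addr0.
rewrite {1}/U u_altcount altcount_rec natrM natrD mulrDr /= add0r; congr (_ * _ + _ * _).
  by rewrite /U u_altcount.
(* The product has one term more than the recurrence; its factor is the constant coefficient of
   [ssub U sone], which is 0. *)
rewrite natr_sum /smul big_ord_recr /= subnn {2}/ssub /U u_altcount altcount_0 subrr mulr0 addr0.
apply: eq_bigr => j _; rewrite natrM /ssub /U u_altcount.
suff -> : sone (n - j)%N = 0 by rewrite subr0.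
by rewrite /sone /sconst subn_eq0 leqNgt ltn_ord.
Qed.

Lemma root_series0 : root_series 0%N = 1.
Proof. by rewrite /root_series /ssub /sscale smulX0 mulr0 subr0. Qed.

Lemma root_series_sqr : smul root_series root_series = ssub sone (sscale 4 sX).
Proof.
have e := catalan_eq; rewrite sscale4 /root_series sscale2.
set C := catalan_series in e *.
(* The Catalan equation times [x]. Substituted for [x] in [1 - 4 x], it turns the goal into a
   polynomial identity. *)
have eX : sX = ssub (smul sX C) (smul sX (smul sX (smul C C))).
  rewrite {1}e; ring.
rewrite [in RHS]eX; ring.
Qed.

(** In [(s - r) (s + r) = 0] the second factor has constant term 2, hence is invertible. *)
Lemma root_series_unique (s : series) : s 0%N = 1 ->
  smul s s = ssub sone (sscale 4 sX) -> s = root_series.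
Proof.
move=> s0; rewrite -root_series_sqr => e.
set r := root_series in e *; pose t := sadd s r.
have t0 : t 0%N != 0 by rewrite /t /sadd s0 /r root_series0.
have st : smul (ssub s r) t = sconst 0.
  transitivity (ssub (smul s s) (smul r r)); first by rewrite /t; ring.
  by rewrite e; ring.
have d0 : ssub s r = sconst 0.
  transitivity (smul (ssub s r) (smul t (sinv t))); first by rewrite smul_sinv //; ring.
  by rewrite smulA st; ring.
transitivity (sadd (ssub s r) r); first by ring.
by rewrite d0; ring.
Qed.

Lemma U_root : smul U (ssub root_series (sscale 2 sX)) = root_series.
Proof.
have e := U_eq; rewrite /root_series !sscale2 in e *.
set C := catalan_series in e *.
set rhs := (X in _ = X).
(* The two sides of the goal differ exactly by the difference of the two sides of [U_eq], which is
   added explicitly and then cancelled. *)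
transitivity (sadd rhs (ssub U (sadd sone (sadd (sadd (smul sX U) (smul sX U))
  (sadd (smul sX (smul C (ssub U sone))) (smul sX (smul C (ssub U sone)))))))).
  by rewrite /rhs; ring.
by rewrite -e; ring.
Qed.

Lemma U_sqrt : U = smul root_series (sinv (ssub root_series (sscale 2 sX))).
Proof.
set d := ssub _ _; have d0 : d 0%N != 0.
  by rewrite /d /ssub root_series0 /sscale mulr0 subr0.
transitivity (smul U (smul d (sinv d))); first by rewrite smul_sinv //; ring.
by rewrite smulA /d U_root.
Qed.

(* The tails of the infinite continued fraction; levels start at 1, and the
   value at 0 is irrelevant. *)
Definition cf_limit (j : nat) : series :=
  match j with
  | 0 | 1 => U
  | 2 => sinv root_series
  | _ => catalan_series
  end.

Lemma cf_limit0 j : cf_limit j 0%N = 1.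
Proof.
have U0 : U 0%N = 1 by rewrite /U u_altcount altcount_0.
case: j => [|[|[|j]]] //=; last by rewrite /catalan_series count132_0.
by rewrite /sinv /= root_series0 invr1.
Qed.

(** By uniqueness of inverses each level is a product equal to 1: [U (1 - 2 x / r)] with [r] the
    root, then [(1 / r) (1 - 2 x C)], then [C (1 - x C)]. *)
Lemma cf_limitE j : (0 < j)%N -> cf_limit j =
  sinv (ssub sone (sscale (cf_num j) (smul sX (cf_limit j.+1)))).
Proof.
move=> j0; apply: sinv_unique.
  by rewrite /ssub /sscale smulX0 mulr0 subr0.
case: j j0 => // -[|[|j]] _ /=; rewrite /cf_num /=.
- have r0 : root_series 0%N != 0 by rewrite root_series0.
  rewrite sscale2; set r := root_series in r0 *.
  transitivity (smul (smul U (ssub r (sscale 2 sX))) (sinv r)).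
    rewrite -[in LHS](smul_sinv r r0) sscale2; ring.
  by rewrite U_root smul_sinv.
- have r0 : root_series 0%N != 0 by rewrite root_series0.
  by rewrite -/root_series smulC smul_sinv.
rewrite sscale1; have e := catalan_eq; set C := catalan_series in e *.
transitivity (ssub C (smul sX (smul C C))); first by ring.
by rewrite {1}e; ring.
Qed.

(** The factor [x] at each level gains one correct coefficient. The induction starts from the
    innermost 1, which agrees with every tail at order 0. *)
Lemma cf_tail_limit k j n : (0 < j)%N -> (n <= k)%N -> cf_tail k j n = cf_limit j n.
Proof.
elim: k j n => [|k IH] j n j0 nk.
  by move: nk; rewrite leqn0 => /eqP ->; rewrite cf_limit0.
rewrite (cf_limitE j j0) /=; apply: (sinv_eq_upto _ _ k.+1) => // -[|i] ik.
  by rewrite /ssub /sscale !smulX0.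
by rewrite /ssub /sscale !smulXS IH.
Qed.

Theorem theorem6p6 :
  (* sqrt(1-4x) exists as a formal power series with constant term 1 ... *)
  (exists s : series, s 0%N = 1 /\
     forall n, smul s s n = ssub sone (sscale 4 sX) n) /\
  (* ... and for it, U = sqrt(1-4x) / (sqrt(1-4x) - 2x) *)
  (forall s : series, s 0%N = 1 ->
     (forall n, smul s s n = ssub sone (sscale 4 sX) n) ->
     forall n, U n = smul s (sinv (ssub s (sscale 2 sX))) n) /\
  (* U equals the continued fraction: the x^n coefficient of the m-th
     convergent equals u_n as soon as m > n *)
  (forall n m : nat, (n < m)%N -> U n = cf_convergent m n).
Proof.
split; first by exists root_series; rewrite root_series0 root_series_sqr.
split=> [s s0 /series_ext ss n|n m /ltnW nm].
  by rewrite (root_series_unique s s0 ss) -U_sqrt.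
by rewrite /cf_convergent cf_tail_limit.
Qed.
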